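(* Let $p\in[0,1]$ and let $(x_i)_{i\in\mathbb{Z}}$ be independent and identically distributed $\{0,1\}$-valued random variables with $\Pr(x_i=1)=p$ and $\Pr(x_i=0)=1-p$. Then for every integer $n>1$ and every $i\in\mathbb{Z}$, the expected value of cell $i$ after $n$ iterations of rule 156 is $$\langle [F^n_{156}(x)]_i\rangle=\frac{1}{2}+\frac{p^{n+3}}{1+p}+\frac{(1-p)^{n+3}}{p-2}+\frac{1}{2}\,\frac{p(p-1)(2p-1)(-1)^n}{(1+p)(p-2)}.$$
   Context: The local function of elementary cellular automaton rule 156 is $f_{156}:\{0,1\}^3\to\{0,1\}$, equal to $1$ exactly on $010,011,100,111$ and $0$ otherwise. The global function $F_{156}:\{0,1\}^{\mathbb{Z}}\to\{0,1\}^{\mathbb{Z}}$ is $[F_{156}(x)]_i=f_{156}(x_{i-1},x_i,x_{i+1})$, and $F_{156}^n$ is its $n$-fold composition. $\langle\cdot\rangle$ denotes expectation with respect to the random initial configuration $x=(x_i)_{i\in\mathbb{Z}}$. *)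

(* Defs.v *)
From HB Require Import structures.
From mathcomp Require Import all_boot all_order all_algebra finmap.
From mathcomp Require Import all_classical all_reals all_analysis.

Set Implicit Arguments.
Unset Strict Implicit.
Unset Printing Implicit Defensive.

Import Order.TTheory GRing.Theory Num.Theory.

Local Open Scope classical_set_scope.
Local Open Scope ring_scope.

Definition f156 (a b c : bool) : bool :=
  match a, b, c with
  | false, true, false
  | false, true, true
  | true, false, false
  | true, true, true => true
  | _, _, _ => false
  end.

Definition F156 (x : int -> bool) : int -> bool :=
  fun i => f156 (x (i - 1)) (x i) (x (i + 1)).

(* Mutual independence: the product rule over every finite subfamily. *)
Definition mutually_independent (R : realType) (d d' : measure_display)
    (T : measurableType d) (T' : measurableType d') (P : probability T R)
    (I : choiceType) (X : I -> {RV P >-> T'}) : Prop :=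
  forall (J : {fset I}) (B : I -> set T'),
    (forall j, j \in J -> measurable (B j)) ->
    P (\bigcap_(j in [set` J]) X j @^-1` B j) =
    (\prod_(j <- J) P (X j @^-1` B j))%E.

(* Main.v *)
(** Rule 156 flips a cell exactly when its left neighbour is 1 and its right
   neighbour is 0.  So every 01 is frozen, and between frozen walls a segment
   1..10..0 evolves on its own: the boundary 10 recedes into the 1s one cell per
   step, leaving an alternating debris whose phase is set by the parity of the
   time and by the cell after the first 0.  Hence, for a cell that starts at 1,
   being 1 at time n is a disjoint union of explicit cylinders, one
   geometric-type term for each distance to the end of the block.  Cells that
   start at 0 follow from the symmetry reflection + complement, which exchanges
   p and 1 - p.  If S_n(p) is the probability of being 1 at times 0 and n, the
   expectation is (1 - p) + S_n(p) - S_n(1 - p), and S_{n+2}(p) - S_n(p) =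
   p^(n+3) (p - 1) for n > 1 reduces the closed form to n = 2, 3. *)

Require Import Defs.
From HB Require Import structures.
From mathcomp Require Import all_boot all_order all_algebra finmap.
From mathcomp Require Import all_classical all_reals all_analysis.
From mathcomp Require Import zify ring lra.

Set Implicit Arguments.
Unset Strict Implicit.
Unset Printing Implicit Defensive.

Import Order.TTheory GRing.Theory Num.Theory.

Local Open Scope classical_set_scope.
Local Open Scope ring_scope.

Implicit Types (x : int -> bool) (i a : int) (s : seq bool).

(** * Local dynamics of rule 156 *)

Lemma F156_addition x i : F156 x i = x i (+) (x (i - 1) && ~~ x (i + 1)).
Proof. by rewrite /F156; case: (x (i - 1)); case: (x i); case: (x (i + 1)). Qed.

Definition mirror x : int -> bool := fun i => ~~ x (- i).

Lemma iter_F156_mirror n x : iter n F156 (mirror x) = mirror (iter n F156 x).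
Proof.
elim: n => //= n ->; apply/funext => i; rewrite /mirror !F156_addition.
rewrite (_ : - (i - 1) = - i + 1); last by lia.
rewrite (_ : - (i + 1) = - i - 1); last by lia.
by case: (iter n F156 x (- i - 1)); case: (iter n F156 x (- i));
  case: (iter n F156 x (- i + 1)).
Qed.

(** Neither cell can flip: the 0 has a 1 on its right, the 1 has a 0 on its left. *)
Lemma iter_F156_fixed01 n x i : x (i - 1) = false -> x i = true ->
  iter n F156 x (i - 1) = false /\ iter n F156 x i = true.
Proof.
move=> x0 x1; elim: n => //= n [y0 y1]; rewrite !F156_addition subrK y0 y1.
by rewrite andbF.
Qed.

(** A 1 followed by a 1 does not flip, so a run of 1s loses at most its last cell per step. *)
Lemma iter_F156_ones n x i : (forall k, (k <= n)%N -> x (i + k%:Z)) ->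
  iter n F156 x i.
Proof.
elim: n x => [|n IHn] x x1; first by have := x1 0%N isT; rewrite addr0.
rewrite iterSr; apply: IHn => k kn; rewrite F156_addition x1; last by lia.
rewrite (_ : i + k%:Z + 1 = i + k.+1%:Z); last by lia.
by rewrite x1 ?andbF//; lia.
Qed.

(* In the frame of the receding boundary, the cell after the first 0 is
   complemented at each step. *)
Lemma iter_F156_erode j x i : x (i - 1) -> x i ->
    (forall k, (k < j)%N -> x (i + k.+1%:Z)) -> x (i + j.+1%:Z) = false ->
  let y := iter j F156 x in
  [/\ y (i - 2) = x (i - 2), y (i - 1), y i, y (i + 1) = false &
      y (i + 2) = x (i + j.+2%:Z) (+) odd j].
Proof.
elim: j x => [|j IHj] x xl xi x1 x0 /=.
  by split => //; rewrite addbF.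
have xi1 : x (i + 1) by apply: (x1 0%N).
have Fe k : (k <= j.+1)%N -> x (i + k%:Z).
  by case: k => [|k kj]; [rewrite addr0 | apply: x1].
have F1 k : (k <= j)%N -> F156 x (i + k%:Z).
  move=> kj; rewrite F156_addition Fe; last by lia.
  rewrite (_ : i + k%:Z + 1 = i + k.+1%:Z); last by lia.
  by rewrite x1 ?andbF.
have [] := IHj (F156 x).
- by rewrite F156_addition subrK xl xi andbF.
- by have := F1 0%N isT; rewrite addr0.
- by move=> k kj; apply: F1.
- rewrite F156_addition Fe//.
  rewrite (_ : i + j.+1%:Z - 1 = i + j%:Z); last by lia.
  rewrite (_ : i + j.+1%:Z + 1 = i + j.+2%:Z); last by lia.
  by rewrite Fe ?x0.
rewrite -!iterSr /= => -> -> -> -> ->; split => //.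
  rewrite F156_addition (_ : i - 2 + 1 = i - 1) ?xl ?andbF ?addbF//; lia.
(* The first 0 has a 1 on its left, so it becomes the complement of the cell on its right. *)
rewrite F156_addition x0.
rewrite (_ : i + j.+2%:Z - 1 = i + j.+1%:Z); last by lia.
rewrite (_ : i + j.+2%:Z + 1 = i + j.+3%:Z); last by lia.
by rewrite Fe//=; case: (x _); case: (odd j).
Qed.

(* When the block erodes down to [i], the cell is frozen at 0 if [i + 2] is then
   0; otherwise it returns to 1, where it is frozen if the block extends left to
   [i - 2], and oscillates with period two if not. *)
Lemma iter_F156_eroded m x i : x (i - 1) -> x i -> x (i + 1) = false ->
  iter m.+1 F156 x i =
  [&& x (i + 2), (0 < m)%N & x (i - 2) || odd m].
Proof.
move=> xl xi xr.
have Fi : F156 x i = false by rewrite F156_addition xl xi xr.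
have Fl : F156 x (i - 1) by rewrite F156_addition subrK xl xi andbF.
have Fll : F156 x (i - 2) = x (i - 2).
  rewrite F156_addition (_ : i - 2 + 1 = i - 1) ?xl ?andbF ?addbF//; lia.
have Fr : F156 x (i + 1) = ~~ x (i + 2).
  rewrite F156_addition xr addrK xi (_ : i + 1 + 1 = i + 2)//; lia.
rewrite iterSr; case: (boolP (x (i + 2))) => [xrr|] /=; last first.
  rewrite -Fr => Fr1.
  have [] := @iter_F156_fixed01 m (F156 x) (i + 1) _ Fr1; rewrite addrK//.
have Fr0 : F156 x (i + 1) = false by rewrite Fr xrr.
have Frr : F156 x (i + 2) = true.
  by rewrite F156_addition (_ : i + 2 - 1 = i + 1) ?xr ?xrr//; lia.
have G t : iter t F156 (F156 x) (i + 1) = false.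
  have [] := @iter_F156_fixed01 t (F156 x) (i + 2) _ Frr.
    by rewrite (_ : i + 2 - 1 = i + 1)//; lia.
  by rewrite (_ : i + 2 - 1 = i + 1)//; lia.
case: m => [|m]; first by rewrite /= Fi.
case: (boolP (x (i - 2))) => [xll|xll] /=.
  (* The next step turns the cells [i - 1], [i] from 10 into a frozen 01. *)
  rewrite -[F156 _]/(iter m.+1 F156 (F156 x)) iterSr.
  have [||] := @iter_F156_fixed01 m (F156 (F156 x)) i => //.
    rewrite F156_addition subrK Fl Fi (_ : i - 1 - 1 = i - 2) ?Fll ?xll//; lia.
  by rewrite F156_addition Fl Fi Fr0.
(* With [i - 1] frozen at 1 and [i + 1] at 0, cell [i] flips at every step. *)
have H t : iter t F156 (F156 x) (i - 1) = true.
  have [||] := @iter_F156_fixed01 t (F156 x) (i - 1) => //.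
  rewrite (_ : i - 1 - 1 = i - 2) ?Fll; [exact: negbTE|lia].
rewrite -[~~ odd m]/(odd m.+1) -[F156 _]/(iter m.+1 F156 (F156 x)).
elim: m.+1 => [//|t IHt].
by rewrite iterS F156_addition G H IHt /=; case: (odd t).
Qed.

(** * Cylinders for the survival of a 1, and their mirror images *)

Fixpoint occurs x a s :=
  if s is b :: s' then (x a == b) && occurs x (a + 1) s' else true.

Lemma occurs_cat x a s1 s2 :
  occurs x a (s1 ++ s2) = occurs x a s1 && occurs x (a + (size s1)%:Z) s2.
Proof.
elim: s1 a => [|b s IHs] a /=; first by rewrite addr0.
by rewrite IHs andbA (_ : a + 1 + (size s)%:Z = a + (size s).+1%:Z)//; lia.
Qed.


Lemma occurs_nseqP x a m :
  reflect (forall k, (k < m)%N -> x (a + k%:Z)) (occurs x a (nseq m true)).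
Proof.
elim: m a => [|m IHm] a /=; first by left.
rewrite eqb_id; apply: (iffP andP) => [[xa /IHm xr] [|k] km|xr].
- by rewrite addr0.
- by rewrite (_ : a + k.+1%:Z = a + 1 + k%:Z); [exact: xr|lia].
- split; first by have := xr 0%N isT; rewrite addr0.
  apply/IHm => k km; rewrite (_ : a + 1 + k%:Z = a + k.+1%:Z); last by lia.
  exact: xr.
Qed.

(** Read from [i + 1]: the rest of the block, its first 0, and the letter that [j] complementations
    turn into 1. *)
Definition block_end (j : nat) : seq bool := nseq j true ++ [:: false; ~~ odd j].

(** The first 0 determines [j], so these words exclude one another. *)
Lemma occurs_block_end x a j0 j : (forall k, (k < j0)%N -> x (a + k%:Z)) ->
    x (a + j0%:Z) = false ->
  occurs x a (block_end j) = (j == j0) && (x (a + j0.+1%:Z) == ~~ odd j0).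
Proof.
move=> x1 x0; rewrite /block_end occurs_cat size_nseq /= andbT.
have [->|nj] := eqVneq j j0.
  rewrite x0 /= (_ : a + j0%:Z + 1 = a + j0.+1%:Z); last by lia.
  by move/occurs_nseqP: x1 => ->.
have [jj|] := ltnP j j0; first by rewrite x1//= andbF.
rewrite leq_eqVlt eq_sym (negbTE nj) /= => jj.
by case: occurs_nseqP => // /(_ _ jj); rewrite x0.
Qed.

(* Disjoint cylinders (start, word) covering the event that cell [i] is 1 both
   initially and after [n] steps: the cell starts a block, or its block has not
   eroded down to it yet, or it flipped to 0 at time [j + 1] and is back at 1;
   the last letter of [block_end j] ensures that the cell is not frozen at 0. *)
Definition live_cylinders (n : nat) i : seq (int * seq bool) :=
  [:: (i - 1, [:: false; true]), (i - 1, nseq n.+2 true)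
    & [seq if odd (n - j) then (i - 2, [:: true, true, true & block_end j])
           else (i - 1, [:: true, true & block_end j]) | j <- iota 0 n.-1]].

(** A count with values 0 and 1 expresses covering and disjointness at once. *)
Lemma count_live_cylinders n x i :
  count (fun l => occurs x l.1 l.2) (live_cylinders n i) =
  (x i && iter n F156 x i) :> nat.
Proof.
have e1 : i - 2 + 1 = i - 1 by lia.
rewrite /live_cylinders /= !subrK !eqb_id count_map.
rewrite (eq_count (a2 := fun j => [&& x (i - 1), x i,
    odd (n - j) ==> x (i - 2) & occurs x (i + 1) (block_end j)])); last first.
  move=> j /=; case: ifP => _; rewrite /= ?e1 subrK !eqb_id//.
  by case: (x (i - 2)); case: (x (i - 1)); case: (x i).
case xi: (x i); last first.
  by rewrite !andbF (eq_count (a2 := pred0)) ?count_pred0 => [|j] /=;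
    rewrite ?andbF.
case xl: (x (i - 1)); last first.
  rewrite (eq_count (a2 := pred0)) ?count_pred0//=.
  by have [_ ->] := iter_F156_fixed01 n xl xi.
rewrite /= add0n ?andbT.
case: occurs_nseqP => [x1|x0].
  rewrite iter_F156_ones; last first.
    case=> [_|k kn]; first by rewrite addr0.
    by rewrite (_ : i + k.+1%:Z = i + 1 + k%:Z); [exact: x1|lia].
  rewrite (eq_in_count (a2 := pred0)) ?count_pred0// => j.
  rewrite mem_iota => /andP[_ jn] /=; apply/negbTE; rewrite negb_and.
  apply/orP; right; rewrite /block_end occurs_cat size_nseq /= x1; last by lia.
  by rewrite andbF.
have [j [jn xj x1]] : exists j, [/\ (j < n)%N, x (i + 1 + j%:Z) = false &
    forall k, (k < j)%N -> x (i + 1 + k%:Z)].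
  have ex0 : exists k, (k < n)%N && ~~ x (i + 1 + k%:Z).
    apply: contrapT => nex; apply: x0 => k kn; apply: contrapT => /negP xk.
    by apply: nex; exists k; rewrite kn.
  case: (ex_minnP ex0) => j /andP[jn /negbTE xj] jmin; exists j; split=> // k kj.
  apply: contrapT => /negP xk; have := jmin k.
  by rewrite xk (ltn_trans kj jn) => /(_ isT); rewrite leqNgt kj.
have /= [||k kj||yll yl yi yr yrr] := @iter_F156_erode j x i.
- by rewrite xl.
- by rewrite xi.
- by rewrite (_ : i + k.+1%:Z = i + 1 + k%:Z); [exact: x1|lia].
- by rewrite -xj; congr x; lia.
(* After [j] steps the boundary reaches [i], one more step flips [i] to 0, and [n - j.+1] steps
   remain. *)
rewrite (_ : n = ((n - j.+1).+1 + j)%N); last by lia.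
rewrite iterD iter_F156_eroded// yll yrr.
set m := (n - j.+1)%N; set c := x (i + j.+2%:Z).
rewrite (eq_count (a2 := fun k => (k == j) &&
   ((odd m.+1 ==> x (i - 2)) && (c (+) odd j)))); last first.
  move=> k /=; rewrite (occurs_block_end _ x1 xj).
  rewrite (_ : i + 1 + j.+1%:Z = i + j.+2%:Z); last by lia.
  rewrite -/c; have [->|] := eqVneq k j; last by rewrite andbF.
  rewrite addnK /=; congr (_ && _); by case: c; case: (odd j).
have -> b r : count (fun k : nat => (k == j) && b) r = (count_mem j r * b)%N.
  case: b; last first.
    by rewrite muln0 (eq_count (a2 := pred0)) ?count_pred0// => k /=; rewrite andbF.
  by rewrite muln1; apply: eq_count => k; rewrite /= andbT.
rewrite count_uniq_mem ?iota_uniq// mem_iota /= add0n mulnb; congr nat_of_bool.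
(* The list omits j = n - 1, for which [i] has only just become 0. *)
rewrite (_ : (j < _)%N = (0 < m)%N); last by rewrite /m; lia.
case: (c (+) odd j); rewrite ?andbF//= andbT.
by case: m => [|m]//=; case: (odd m); case: (x (i - 2)).
Qed.

(** Reflection sends the cells a, ..., a + s - 1 to 1 - a - s, ..., -a, whence the new start. *)
Definition mirror_cylinder (l : int * seq bool) : int * seq bool :=
  (1 - l.1 - (size l.2)%:Z, rev (map negb l.2)).

Lemma occurs_mirror x l : occurs (mirror x) l.1 l.2 =
  occurs x (mirror_cylinder l).1 (mirror_cylinder l).2.
Proof.
case: l => a s; rewrite /mirror_cylinder /=.
elim: s a => [|b s IHs] a //=.
rewrite IHs rev_cons -cats1 occurs_cat size_rev size_map /= andbT andbC.
rewrite (_ : 1 - (a + 1) - (size s)%:Z = 1 - a - (size s).+1%:Z); last by lia.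
rewrite (_ : _ + (size s)%:Z = - a); last by lia.
by rewrite /mirror; case: (x (- a)); case: b.
Qed.

(** The mirrored cylinders count the cells that are 0 at both times. Adding them on the left avoids
    subtraction in [nat]. *)
Lemma iter_F156_count n x i :
  (iter n F156 x i + count (fun l => occurs x l.1 l.2)
     (map mirror_cylinder (live_cylinders n (- i))) =
  count (fun l => occurs x l.1 l.2) ((i, [:: false]) :: live_cylinders n i))%N.
Proof.
rewrite count_map -(eq_count (fun l => occurs_mirror x l)) count_live_cylinders.
rewrite iter_F156_mirror -cat1s count_cat count_live_cylinders /mirror !opprK /=.
by case: (x i); case: (iter n F156 x i).
Qed.

(** * Probabilities of cylinders and expectation *)

Definition bern (R : realType) (p : R) (b : bool) : R := if b then p else 1 - p.

Definition word_weight (R : realType) (p : R) (s : seq bool) : R :=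
  \prod_(b <- s) bern p b.

Lemma bern_neg (R : realType) (p : R) b : bern p (~~ b) = bern (1 - p) b.
Proof. by case: b; rewrite /bern //= subKr. Qed.

Lemma word_weight_mirror (R : realType) (p : R) l :
  word_weight p (mirror_cylinder l).2 = word_weight (1 - p) l.2.
Proof.
rewrite /word_weight big_rev big_map; apply: eq_bigr => b _; exact: bern_neg.
Qed.

Section cylinder_probability.
Context d (T : measurableType d) (R : realType) (P : probability T R).
Variables (p : R) (x : int -> {RV P >-> bool}).
Hypothesis hindep : mutually_independent x.
Hypothesis hx : forall j b, P (x j @^-1` [set b]) = (bern p b)%:E.

Definition cylinder (l : int * seq bool) : set T :=
  [set w | occurs (fun j => x j w) l.1 l.2].

(** This is the form to which the product rule applies. Every [j] lies within the word, so neither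
    [absz] nor the default of [nth] distorts a letter. *)
Lemma cylinderE l : cylinder l =
  \bigcap_(j in [set` [fset (l.1 + k%:Z)%R | k in iota 0 (size l.2)]%fset])
    x j @^-1` [set nth false l.2 (absz (j - l.1)%R)].
Proof.
case: l => a s; rewrite /cylinder /=; apply/seteqP; split=> w /=.
- move=> xs j /=; rewrite -/(is_true _) => /imfsetP[k /=].
  rewrite mem_iota /= add0n => ks ->.
  rewrite (_ : a + k%:Z - a = k%:Z) ?absz_nat; last by lia.
  elim: s a k xs ks => [|b s IHs] a [|k]//= /andP[/eqP xa xs] ks.
    by rewrite addr0.
  by rewrite -(IHs _ _ xs ks); congr (x _ w); lia.
- move=> xs; have {}xs k : (k < size s)%N -> x (a + k%:Z) w = nth false s k.
    move=> ks; rewrite (xs (a + k%:Z)).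
      by rewrite (_ : a + k%:Z - a = k%:Z) ?absz_nat//; lia.
    by apply/imfsetP; exists k; rewrite //= mem_iota.
  elim: s a xs => [//|b s IHs] a xs /=; apply/andP; split.
    by have := xs 0%N isT; rewrite addr0 => ->.
  by apply: IHs => k ks; have /= <- := xs k.+1 ks; congr (x _ w); lia.
Qed.

Lemma measurable_cylinder l : measurable (cylinder l).
Proof.
rewrite cylinderE; apply: fin_bigcap_measurable => [|j _]; first exact: finite_fset.
by rewrite -[_ @^-1` _]setTI; apply: measurable_funP.
Qed.

Lemma cylinder_probability l : P (cylinder l) = (word_weight p l.2)%:E.
Proof.
rewrite cylinderE hindep//; case: l => a s /=.
set J := [fset _ | _ in _]%fset.
have perm_J : perm_eq J [seq (a + k%:Z)%R | k <- iota 0 (size s)].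
  apply: uniq_perm; first exact: fset_uniq.
    by rewrite map_inj_uniq ?iota_uniq// => k k' /addrI [].
  by move=> j; apply/imfsetP/mapP => -[k /= ? ?]; exists k.
rewrite (perm_big _ perm_J) big_map /word_weight (big_nth false) -prodEFin.
rewrite /index_iota subn0; apply: eq_bigr => k _.
by rewrite (_ : a + k%:Z - a = k%:Z) ?absz_nat ?hx//; lia.
Qed.

Let count_cylinder (L : seq (int * seq bool)) : T -> R :=
  fun w => (count (fun l => occurs (fun j => x j w) l.1 l.2) L)%:R.

Let count_cylinder_cons l L :
  count_cylinder (l :: L) = \1_(cylinder l) \+ count_cylinder L.
Proof.
apply/funext => w; rewrite /count_cylinder /= natrD indicE; congr (_%:R + _).
by rewrite /cylinder; congr nat_of_bool; apply/idP/idP => [xw|/set_mem//];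
  apply: mem_set.
Qed.

Let Lfun_indic l : \1_(cylinder l) \in Lfun P 1.
Proof. exact/Lfun1_integrable/integrable_indic/measurable_cylinder. Qed.

Let Lfun_count_cylinder L : count_cylinder L \in Lfun P 1.
Proof.
elim: L => [|l L IHL]; first exact: (Lfun_cst P 0 1).
by rewrite count_cylinder_cons rpredD.
Qed.

Let expectation_count_cylinder L :
  'E_P[count_cylinder L]%E = (\sum_(l <- L) word_weight p l.2)%:E.
Proof.
elim: L => [|l L IHL]; first by rewrite big_nil; exact: expectation_cst.
rewrite count_cylinder_cons expectationD// IHL big_cons EFinD.
by rewrite expectation_indic ?cylinder_probability//; exact: measurable_cylinder.
Qed.

Lemma expectation_iter_F156 n i :
  'E_P[fun w : T => (iter n F156 (fun j : int => x j w) i)%:R]%E =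
  (1 - p + \sum_(l <- live_cylinders n i) word_weight p l.2
   - \sum_(l <- live_cylinders n (- i)) word_weight (1 - p) l.2)%:E.
Proof.
rewrite [X in 'E_P[X]%E](_ : _ =
    count_cylinder ((i, [:: false]) :: live_cylinders n i) \-
    count_cylinder (map mirror_cylinder (live_cylinders n (- i)))); last first.
  apply/funext => w; apply: (canRL (addrK _)); rewrite -natrD.
  by congr _%:R; exact: iter_F156_count.
rewrite expectationB// !expectation_count_cylinder -EFinB big_cons big_map.
congr (_ + _ - _)%:E; first by rewrite /word_weight big_seq1.
by apply: eq_bigr => l _; exact: word_weight_mirror.
Qed.

End cylinder_probability.

(** * Recurrence and closed form *)

Definition live_probability (R : realType) (n : nat) (p : R) : R :=
  p * (1 - p) + p ^+ n.+2 +
  \sum_(0 <= j < n.-1) (if odd (n - j) then p else 1) *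
    (p ^+ j.+2 * (1 - p) * bern p (~~ odd j)).

Lemma sum_live_cylinders (R : realType) (p : R) n i :
  \sum_(l <- live_cylinders n i) word_weight p l.2 = live_probability n p.
Proof.
have consE b s : word_weight p (b :: s) = bern p b * word_weight p s.
  by rewrite /word_weight big_cons.
have nilE : word_weight p [::] = 1 by rewrite /word_weight big_nil.
have nseqE m s : word_weight p (nseq m true ++ s) = p ^+ m * word_weight p s.
  by elim: m => [|m IHm]; rewrite ?mul1r//= consE IHm exprS mulrA.
rewrite /live_cylinders !big_cons big_map /live_probability addrA.
congr (_ + _ + _).
- by rewrite !consE nilE /bern; ring.
- by rewrite -[nseq _ _]cats0 nseqE nilE mulr1.
rewrite /index_iota subn0; apply: eq_bigr => j _.
set c := bern p (~~ odd j).
by case: ifP => _; rewrite /= !consE nseqE !consE nilE -/c /bern !exprS; ring.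
Qed.

(** The parity of [n - j] is unchanged, so the old summands persist. The two new ones have equal
    prefactors and [bern] factors p and 1 - p in some order, so they add up to p^(m+4) (1 - p). *)
Lemma live_probabilityS2 (R : realType) (p : R) m :
  live_probability m.+4 p = live_probability m.+2 p + p ^+ m.+4 * p * (p - 1).
Proof.
rewrite /live_probability /= 2?big_nat_recr//=.
rewrite (_ : odd (m.+4 - m.+2) = false); last by rewrite (_ : (_ - _ = 2)%N)//; lia.
rewrite (_ : odd (m.+4 - m.+1)); last by rewrite (_ : (_ - _ = 3)%N)//; lia.
rewrite (eq_big_nat _ _ (F2 := fun j => (if odd (m.+2 - j) then p else 1) *
    (p ^+ j.+2 * (1 - p) * bern p (~~ odd j)))); last first.
  move=> j /andP[_ jm].
  by rewrite (_ : m.+4 - j = (m.+2 - j).+2)%N; [rewrite /= negbK|lia].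
set X := bigop _ _ _; rewrite !negbK !exprS.
by case: (odd m); rewrite /bern /=; ring.
Qed.

Theorem mainTheorem2 (R : realType) (d : measure_display)
    (T : measurableType d) (P : probability T R)
    (p : R) (hp0 : 0 <= p) (hp1 : p <= 1)
    (x : int -> {RV P >-> bool})
    (hindep : mutually_independent x)
    (hx1 : forall j : int, P (x j @^-1` [set true]) = p%:E)
    (hx0 : forall j : int, P (x j @^-1` [set false]) = (1 - p)%:E)
    (n : nat) (hn : (1 < n)%N) (i : int) :
  'E_P[fun w : T => (iter n F156 (fun j : int => x j w) i)%:R]%E =
  (1 / 2 + p ^+ (n + 3) / (1 + p) + (1 - p) ^+ (n + 3) / (p - 2)
   + 1 / 2 * (p * (p - 1) * (2 * p - 1) * (-1) ^+ n / ((1 + p) * (p - 2))))%:E.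
Proof.
have hx j b : P (x j @^-1` [set b]) = (bern p b)%:E by case: b.
rewrite (expectation_iter_F156 hindep hx) !sum_live_cylinders; congr EFin.
have p1 : 1 + p != 0 by lra.
have p2 : p - 2 != 0 by lra.
rewrite addn3; case: n hn => [|[|m]] // _.
(* The recurrence has step two, so consecutive values of [n] are proved in pairs. *)
suff [] :
  (1 - p + live_probability m.+2 p - live_probability m.+2 (1 - p) =
    1 / 2 + p ^+ m.+2.+3 / (1 + p) + (1 - p) ^+ m.+2.+3 / (p - 2) +
    1 / 2 * (p * (p - 1) * (2 * p - 1) * (-1) ^+ m.+2 / ((1 + p) * (p - 2)))) /\
  (1 - p + live_probability m.+3 p - live_probability m.+3 (1 - p) =
    1 / 2 + p ^+ m.+3.+3 / (1 + p) + (1 - p) ^+ m.+3.+3 / (p - 2) +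
    1 / 2 * (p * (p - 1) * (2 * p - 1) * (-1) ^+ m.+3 / ((1 + p) * (p - 2)))) by [].
elim: m => [|m [IH2 IH3]].
  rewrite /live_probability !big_nat_recr //= !big_geq // /bern /=.
  by rewrite !exprS; split; field; rewrite p1 p2.
split => //; rewrite !live_probabilityS2.
transitivity (1 - p + live_probability m.+2 p - live_probability m.+2 (1 - p)
  + (p ^+ m.+4 * p * (p - 1) - (1 - p) ^+ m.+4 * (1 - p) * (1 - p - 1))).
  by ring.
by rewrite IH2 !exprS; field; rewrite p1 p2.
Qed.
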